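(* Let $n\ge 3$ be a natural number and let $a_1,a_2,\ldots,a_n$ be the first $n$ terms of a harmonic progression of real numbers. Then $$(n-1)\,a_1a_n=a_1a_2+a_2a_3+\cdots+a_{n-1}a_n.$$
   Context: A sequence of (necessarily nonzero) real numbers $a_1,a_2,\ldots$ is a harmonic progression if the sequence of reciprocals $\frac1{a_1},\frac1{a_2},\ldots$ is an arithmetic progression, i.e. there is a fixed real $d$ with $\frac{1}{a_{k+1}}=\frac1{a_k}+d$ for all $k$. *)

(* Defs.v *)
From mathcomp Require Import all_boot all_order all_algebra.
From mathcomp Require Import reals.

Set Implicit Arguments.
Unset Strict Implicit.
Unset Printing Implicit Defensive.

Import Order.TTheory GRing.Theory Num.Theory.
Local Open Scope ring_scope.

(* A sequence a_1, a_2, ... is a function on nat whose value at 0 is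
   irrelevant.  Nonvanishing is stated explicitly because 0^-1 = 0. *)
Definition harmonic_progression (R : realType) (a : nat -> R) : Prop :=
  (forall k : nat, (1 <= k)%N -> a k != 0) /\
  (exists d : R, forall k : nat, (1 <= k)%N -> (a k.+1)^-1 = (a k)^-1 + d).

(* Main.v *)
Require Import Defs.
From mathcomp Require Import all_boot all_order all_algebra.
From mathcomp Require Import reals.
From mathcomp Require Import ring.

Import Order.TTheory GRing.Theory Num.Theory.
Local Open Scope ring_scope.

(** The terms are the reciprocals of [x + (k - 1) d] with [x = 1 / a_1], so the
    identity follows by induction on the number of summands, starting from the
    empty sum (lemma [sum_adjacent_products]): adding the next product
    amounts to the rational identity
    [m / (x (x + m d)) + 1 / ((x + m d) (x + (m + 1) d))
       = (m + 1) / (x (x + (m + 1) d))],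
    whose numerators agree because
    [m (x + (m + 1) d) + x = (m + 1) (x + m d)]. *)

Lemma inv_affine (R : fieldType) (a : nat -> R) (d : R)
    (ad : forall k : nat, (1 <= k)%N -> (a k.+1)^-1 = (a k)^-1 + d) (m : nat) :
  (a m.+1)^-1 = (a 1%N)^-1 + m%:R * d.
Proof.
elim: m => [|m IHm]; first by rewrite mul0r addr0.
by rewrite ad // IHm -addrA mulrSr mulrDl mul1r.
Qed.

Lemma sum_adjacent_products (R : realType) (a : nat -> R)
    (ha : harmonic_progression a) (m : nat) :
  \sum_(1 <= k < m.+1) a k * a k.+1 = m%:R * a 1%N * a m.+1.
Proof.
case: ha => a_neq0 [d ad].
elim: m => [|m IHm]; first by rewrite big_geq // !mul0r.
rewrite big_nat_recr //= IHm.
have x_neq0 : (a 1%N)^-1 != 0 by rewrite invr_neq0 ?a_neq0.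
have y_neq0 : (a 1%N)^-1 + m%:R * d != 0.
  by rewrite -(inv_affine _ _ _ ad m) invr_neq0 ?a_neq0.
have z_neq0 : (a 1%N)^-1 + m.+1%:R * d != 0.
  by rewrite -(inv_affine _ _ _ ad m.+1) invr_neq0 ?a_neq0.
(* With [x], the reciprocal of [a 1], as the variable, the denominators are
   exactly the three quantities shown to be nonzero. *)
rewrite -[a m.+1]invrK -[a m.+2]invrK (inv_affine _ _ _ ad m)
  (inv_affine _ _ _ ad m.+1).
have a1E : a 1%N = ((a 1%N)^-1)^-1 by rewrite invrK.
move: (a 1%N)^-1 a1E x_neq0 y_neq0 z_neq0 => x ->.
rewrite mulrSr => x_neq0 y_neq0 z_neq0.
by field; rewrite x_neq0 y_neq0 z_neq0.
Qed.

Theorem mainTheorem5 (R : realType) (n : nat) (a : nat -> R)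
    (hn : (3 <= n)%N) (ha : harmonic_progression a) :
  (n - 1)%:R * a 1%N * a n = \sum_(1 <= k < n) a k * a k.+1.
Proof.
case: n hn => // m _.
by rewrite subn1 sum_adjacent_products.
Qed.
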